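(* Let $f,g\colon\mathbb{R}^n\to\mathbb{R}\cup\{+\infty\}$ be lower semicontinuous functions and let $S:=\{x\in\mathbb{R}^n : g(x)\le 0\}$ be nonempty. Assume that $\mathrm{dom}\,f\cap S$ is unbounded, that $f$ is bounded from below on $S$, and that $$-\partial^\infty f(\infty)\cap\Big[\bigcup\{\lambda\circ\partial g(\infty) : \lambda\ge0\}\Big]=\{0\}.$$ If $f$ does not attain its infimum on $S$ and $S$ has an error bound at infinity (i.e., there exist $\alpha>0$ and $R>0$ such that $d(x;S)\le\alpha[g(x)]_+$ for all $x\in\mathbb{R}^n$ with $\|x\|>R$), then there exists $\lambda\ge0$ such that $$0\in\partial f(\infty)+\lambda\circ\partial g(\infty).$$ If in addition $g$ is Lipschitz at infinity, then there exists $\lambda\ge0$ such that $$0\in\partial f(\infty)+\lambda\,\partial g(\infty).$$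
   Context: $\mathbb{R}^n$ carries the Euclidean norm; $d(x;S):=\inf\{\|y-x\| : y\in S\}$; $[t]_+:=\max\{t,0\}$; $\mathrm{dom}\,f:=\{x : f(x)<+\infty\}$; $\mathrm{epi}\,f:=\{(x,\alpha)\in\mathbb{R}^n\times\mathbb{R} : \alpha\ge f(x)\}$. The function $g$ is Lipschitz at infinity if there exist $L>0$ and $R>0$ such that $g$ is finite on $\mathbb{R}^n\setminus\mathbb{B}_R$ and $|g(x)-g(x')|\le L\|x-x'\|$ for all $x,x'\in\mathbb{R}^n\setminus\mathbb{B}_R$, where $\mathbb{B}_R$ is the closed ball of radius $R$ centered at $0$. Normal cones. For $C\subset\mathbb{R}^d$ and $\bar x\in C$, the Fréchet normal cone is $\widehat N(\bar x;C):=\{v\in\mathbb{R}^d : \limsup_{x\to\bar x,\,x\in C}\langle v,x-\bar x\rangle/\|x-\bar x\|\le 0\}$. The limiting normal cone $N(\bar x;C)$ is the set of all $v$ for which there exist $x_k\in C$, $x_k\to\bar x$, and $v_k\in\widehat N(x_k;C)$ with $v_k\to v$. Subdifferentials at infinity. For a lower semicontinuous $h\colon\mathbb{R}^n\to\mathbb{R}\cup\{+\infty\}$ with unbounded domain, let $\mathcal{N}_h$ be the set of all $w\in\mathbb{R}^n\times\mathbb{R}$ for which there exist $x_k\in\mathrm{dom}\,h$ with $\|x_k\|\to\infty$ and $w_k\in N((x_k,h(x_k));\mathrm{epi}\,h)$ with $w_k\to w$. Then $\partial h(\infty):=\{u : (u,-1)\in\mathcal{N}_h\}$ and $\partial^\infty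 h(\infty):=\{u : (u,0)\in\mathcal{N}_h\}$. For $\lambda\ge0$: $\lambda\circ\partial g(\infty):=\lambda\,\partial g(\infty)$ if $\lambda>0$, and $0\circ\partial g(\infty):=\partial^\infty g(\infty)$. Sums of sets are Minkowski sums. The expression $-\partial^\infty f(\infty)\cap A$ means $(-\partial^\infty f(\infty))\cap A$. *)

(* Defs.v *)
From mathcomp Require Import all_boot all_order all_algebra.
From mathcomp Require Import all_classical all_reals all_analysis.
Import Order.TTheory GRing.Theory Num.Theory.
Import numFieldNormedType.Exports.

Set Implicit Arguments.
Unset Strict Implicit.
Unset Printing Implicit Defensive.

Local Open Scope classical_set_scope.
Local Open Scope ring_scope.

(* The library norm on ['rV[R]_n] is the sup norm. It induces the Euclidean
   topology, so library limits and neighborhoods are used, but every metric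
   notion below goes through [enorm]. *)
Definition dotv (R : realType) (n : nat) (u v : 'rV[R]_n) : R :=
  \sum_(i < n) u 0 i * v 0 i.

Definition enorm (R : realType) (n : nat) (u : 'rV[R]_n) : R :=
  Num.sqrt (dotv u u).

Definition unbounded (R : realType) (n : nat) (A : set 'rV[R]_n) : Prop :=
  ~ exists M : R, forall x, A x -> enorm x <= M.

(* [+oo] when [S] is empty. *)
Definition edist (R : realType) (n : nat) (x : 'rV[R]_n) (S : set 'rV[R]_n)
  : \bar R := ereal_inf [set (enorm (y - x))%:E | y in S].

Definition dom (R : realType) (n : nat) (f : 'rV[R]_n -> \bar R)
  : set 'rV[R]_n := [set x | (f x < +oo)%E].

(* R^n x R is identified with R^(n+1), the last coordinate being the real one. *)
Definition pairv (R : realType) (n : nat) (x : 'rV[R]_n) (a : R)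
  : 'rV[R]_(n + 1) := row_mx x (const_mx a).

Definition epi (R : realType) (n : nat) (f : 'rV[R]_n -> \bar R)
  : set 'rV[R]_(n + 1) :=
  [set pairv z.1 z.2 | z in [set z : 'rV[R]_n * R | (f z.1 <= z.2%:E)%E]].

(* The filter is trivial at an isolated point of [C]; the limsup is then [-oo]. *)
Definition frechet_normal (R : realType) (d : nat) (C : set 'rV[R]_d)
    (xbar : 'rV[R]_d) : set 'rV[R]_d :=
  [set v | (limf_esup (fun x : 'rV[R]_d => (dotv v (x - xbar) / enorm (x - xbar))%:E)
              (within C xbar^') <= 0)%E].

Definition limiting_normal (R : realType) (d : nat) (C : set 'rV[R]_d)
    (xbar : 'rV[R]_d) : set 'rV[R]_d :=
  [set v | exists x_ v_ : nat -> 'rV[R]_d,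
     [/\ forall k, C (x_ k), x_ @ \oo --> xbar,
         forall k, frechet_normal C (x_ k) (v_ k) & v_ @ \oo --> v]].

(* [fine (h (x_ k))] is the real value [h (x_ k)]: [x_ k] is in the domain and
   [h] is meant to never be [-oo]. *)
Definition normal_infty (R : realType) (n : nat) (h : 'rV[R]_n -> \bar R)
  : set 'rV[R]_(n + 1) :=
  [set w | exists (x_ : nat -> 'rV[R]_n) (w_ : nat -> 'rV[R]_(n + 1)),
     [/\ forall k, dom h (x_ k),
         enorm (x_ k) @[k --> \oo] --> +oo,
         forall k, limiting_normal (epi h) (pairv (x_ k) (fine (h (x_ k)))) (w_ k)
       & w_ @ \oo --> w]].

Definition subdiff_infty (R : realType) (n : nat) (h : 'rV[R]_n -> \bar R)
  : set 'rV[R]_n := [set u | normal_infty h (pairv u (-1))].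

Definition sing_subdiff_infty (R : realType) (n : nat)
    (h : 'rV[R]_n -> \bar R) : set 'rV[R]_n :=
  [set u | normal_infty h (pairv u 0)].

Definition scale_set (R : realType) (n : nat) (l : R) (A : set 'rV[R]_n)
  : set 'rV[R]_n := [set l *: u | u in A].

Definition add_set (R : realType) (n : nat) (A B : set 'rV[R]_n)
  : set 'rV[R]_n := [set a + b | a in A & b in B].

Definition opp_set (R : realType) (n : nat) (A : set 'rV[R]_n)
  : set 'rV[R]_n := [set - a | a in A].

(* Only meant for [0 <= l]. *)
Definition circ_subdiff_infty (R : realType) (n : nat) (l : R)
    (g : 'rV[R]_n -> \bar R) : set 'rV[R]_n :=
  if l == 0 then sing_subdiff_infty g else scale_set l (subdiff_infty g).

Definition lipschitz_infty (R : realType) (n : nat) (g : 'rV[R]_n -> \bar R)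
  : Prop :=
  exists L r : R, [/\ 0 < L, 0 < r,
    forall x, r < enorm x -> g x \is a fin_num
  & forall x y, r < enorm x -> r < enorm y ->
      (`|g x - g y| <= (L * enorm (x - y))%:E)%E].

Definition error_bound_infty (R : realType) (n : nat) (g : 'rV[R]_n -> \bar R)
    (S : set 'rV[R]_n) : Prop :=
  exists a r : R, [/\ 0 < a, 0 < r &
    forall x, r < enorm x -> (edist x S <= a%:E * maxe (g x) 0)%E].

Definition attains_inf (R : realType) (n : nat) (f : 'rV[R]_n -> \bar R)
    (S : set 'rV[R]_n) : Prop :=
  exists2 x, S x & f x = ereal_inf (f @` S).

(* Main.v *)
Require Import Defs.
From mathcomp Require Import all_boot all_order all_algebra.
From mathcomp Require Import all_classical all_reals all_analysis.
From mathcomp Require Import ring lra.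
Import Order.TTheory GRing.Theory Num.Theory.
Import numFieldNormedType.Exports.
Local Open Scope classical_set_scope.
Local Open Scope ring_scope.

(** The infimum of [f] over [S] is finite and not attained, so by lower
    semicontinuity minimising sequences in [S] escape to infinity
    ([near_minimisers_far]). Given a nearly minimising [x], let [y] minimise
    [f + |. - x|^2] over [S]. Then [y] is far too and, since
    [|y - x|^2 <= f x - inf f], almost a critical point of [f] on [S]
    ([prox_minimiser]).

    This is turned into a multiplier rule with explicit quadratic penalties on
    compact sets, all resting on [compact_penalty]. Splitting the variable into
    a point carrying [f] and a point carrying [S], tied by [j * |a - p|^2],
    gives a normal to [epi f] near [y] that is almost opposite to
    [2 j (a - p)], where [p] is a nearest point of [S] to [a]
    ([decoupled_minimizer]). By the error bound, [p] also minimises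
    [|z - a| + alpha * max (g z, 0)] among far [z]; another penalty argument
    replaces [2 j (a - p)] by a normal [(w, - t)] to [epi g], with [t] at most
    [alpha * |2 j (a - p)|] up to a small error
    ([proximal_normal_error_bound]).

    Far away there are thus normals [(u, - s)] to [epi f] and [(w, - t)] to
    [epi g] with [s] close to 1, [u + w] close to 0 and [t] bounded by a
    multiple of [|u| + 1] ([approximate_multipliers]). Dividing by [1 + |u|] and
    extracting a limit gives [(u, - s)] and [(- u, - t)] normal at infinity to
    [epi f] and [epi g], with [|u| + s = 1] ([normalised_multipliers]). If
    [s = 0], then [u] violates the qualification; otherwise division by [s]
    yields the multiplier [t / s].

    When [g] is Lipschitz at infinity, normals [(w, t)] to its epigraph satisfy
    [|w| <= L * |t|]. Its singular subdifferential at infinity is then at most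
    [{0}], and its subdifferential at infinity is not empty. This settles the
    remaining case [t = 0], with multiplier 0. *)

(** * Continuity of explicit expressions *)

Section Continuity.
Context {R : realType} {T : topologicalType}.

Lemma continuous_addf {V : pseudoMetricNormedZmodType R} (f g : T -> V) :
  continuous f -> continuous g -> continuous (fun t => f t + g t).
Proof. by move=> cf cg t; exact: cvgD (cf t) (cg t). Qed.

Lemma continuous_oppf {V : pseudoMetricNormedZmodType R} (f : T -> V) :
  continuous f -> continuous (fun t => - f t).
Proof. by move=> cf t; exact: cvgN (cf t). Qed.

Lemma continuous_mulf (f g : T -> R) :
  continuous f -> continuous g -> continuous (fun t => f t * g t).
Proof. by move=> cf cg t; exact: cvgM (cf t) (cg t). Qed.

Lemma continuous_normf (f : T -> R) :
  continuous f -> continuous (fun t => `|f t|).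
Proof. by move=> cf t; exact: cvg_norm (cf t). Qed.

Lemma continuous_exprf (f : T -> R) k :
  continuous f -> continuous (fun t => f t ^+ k).
Proof.
by move=> cf t; exact: continuous_cvg (@exprn_continuous R k _) (cf t).
Qed.

Lemma continuous_idf : continuous (fun t : T => t).
Proof. by move=> t. Qed.

Lemma continuous_cstf {U : topologicalType} (c : U) :
  continuous (fun _ : T => c).
Proof. exact: cst_continuous. Qed.

Lemma continuous_fstf {U V : topologicalType} (f : T -> U * V) :
  continuous f -> continuous (fun t => (f t).1).
Proof. by move=> cf t; exact: cvg_comp (cf t) cvg_fst. Qed.

Lemma continuous_sndf {U V : topologicalType} (f : T -> U * V) :
  continuous f -> continuous (fun t => (f t).2).
Proof. by move=> cf t; exact: cvg_comp (cf t) cvg_snd. Qed.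

Lemma near_continuous_lt (F : T -> R) p e :
  continuous F -> F p < e -> nbhs p [set q | F q < e].
Proof. by move=> cF Fe; exact: (cvgr_lt _ (cF p)). Qed.

End Continuity.

(** * Euclidean geometry of row vectors *)

Section Euclid.
Context {R : realType} {n : nat}.
Implicit Types (u v w : 'rV[R]_n) (a b : R).

Lemma dotvC u v : dotv u v = dotv v u.
Proof. by apply: eq_bigr => i _; rewrite mulrC. Qed.

Lemma dotvDl u v w : dotv (u + v) w = dotv u w + dotv v w.
Proof. by rewrite -big_split; apply: eq_bigr => i _; rewrite mxE mulrDl. Qed.

Lemma dotvZl a u v : dotv (a *: u) v = a * dotv u v.
Proof.
by rewrite /dotv mulr_sumr; apply: eq_bigr => i _; rewrite mxE mulrA.
Qed.

Lemma dotvNl u v : dotv (- u) v = - dotv u v.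
Proof. by rewrite -scaleN1r dotvZl mulN1r. Qed.

Lemma dotvDr u v w : dotv w (u + v) = dotv w u + dotv w v.
Proof. by rewrite dotvC dotvDl !(dotvC w). Qed.

Lemma dotvZr a u v : dotv v (a *: u) = a * dotv v u.
Proof. by rewrite dotvC dotvZl (dotvC v). Qed.

Lemma dotvNr u v : dotv v (- u) = - dotv v u.
Proof. by rewrite dotvC dotvNl (dotvC v). Qed.

Lemma dotv0l u : dotv 0 u = 0.
Proof. by rewrite -(scale0r (0 : 'rV[R]_n)) dotvZl mul0r. Qed.

Definition dotv_lin := (dotvDl, dotvDr, dotvNl, dotvNr, dotvZl, dotvZr).

Lemma dotv_shift u v w : dotv (w - u) (w - u) =
  dotv (v - u) (v - u) + 2 * dotv (v - u) (w - v) + dotv (w - v) (w - v).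
Proof.
rewrite -[w - u](subrKA v); move: (w - v) (v - u) => B A.
rewrite !dotv_lin (dotvC B A); ring.
Qed.

Lemma dotv_ge0 u : 0 <= dotv u u.
Proof. by apply: sumr_ge0 => i _; rewrite -expr2 sqr_ge0. Qed.

Lemma enorm_ge0 u : 0 <= enorm u.
Proof. exact: sqrtr_ge0. Qed.

Lemma sqr_enorm u : enorm u ^+ 2 = dotv u u.
Proof. by rewrite sqr_sqrtr // dotv_ge0. Qed.

Lemma enorm_eq0 u : enorm u = 0 -> u = 0.
Proof.
move=> u0; have : dotv u u = 0 by rewrite -sqr_enorm u0 expr0n.
move/eqP; rewrite psumr_eq0 => [|i _]; last by rewrite -expr2 sqr_ge0.
move=> /allP h; apply/rowP => i; rewrite mxE; apply/eqP.
by have := h i (mem_index_enum _); rewrite /= mulf_eq0 orbb.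
Qed.

Lemma enorm_gt0 u : u != 0 -> 0 < enorm u.
Proof.
move=> u0; rewrite lt_neqAle enorm_ge0 andbT eq_sym.
by apply: contra u0 => /eqP/enorm_eq0/eqP.
Qed.

Lemma dotvB_eq0 u v : dotv (u - v) (u - v) = 0 -> u = v.
Proof.
move=> uv; apply/eqP; rewrite -subr_eq0; apply/eqP/enorm_eq0.
by rewrite /enorm uv sqrtr0.
Qed.

Lemma enorm0 : enorm (0 : 'rV[R]_n) = 0.
Proof. by rewrite /enorm dotv0l sqrtr0. Qed.

Lemma enormZ a u : enorm (a *: u) = `|a| * enorm u.
Proof.
by rewrite /enorm !dotv_lin mulrA -expr2 sqrtrM ?sqr_ge0 // sqrtr_sqr.
Qed.

Lemma enormN u : enorm (- u) = enorm u.
Proof. by rewrite /enorm !dotv_lin opprK. Qed.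

Lemma enormB u v : enorm (u - v) = enorm (v - u).
Proof. by rewrite -enormN opprB. Qed.

Lemma dotv_le u v : dotv u v <= enorm u * enorm v.
Proof.
have [->|u0] := eqVneq u 0; first by rewrite dotv0l enorm0 mul0r.
have [->|v0] := eqVneq v 0; first by rewrite dotvC dotv0l enorm0 mulr0.
have := dotv_ge0 (enorm v *: u - enorm u *: v).
rewrite !dotv_lin -!sqr_enorm (dotvC v u) => h.
have pq : 0 < enorm u * enorm v by rewrite mulr_gt0 ?enorm_gt0.
rewrite -(ler_pM2l pq); nra.
Qed.

Lemma enormD u v : enorm (u + v) <= enorm u + enorm v.
Proof.
rewrite -ler_sqr ?nnegrE ?enorm_ge0 ?addr_ge0 ?enorm_ge0 // sqr_enorm.
rewrite !dotv_lin (dotvC v u) sqrrD -!sqr_enorm; have := dotv_le u v; lra.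
Qed.

Lemma enorm_distD u v w : enorm (u - w) <= enorm (u - v) + enorm (v - w).
Proof. by rewrite -[u - w](subrKA v) enormD. Qed.

Lemma enorm_lerB u v : enorm u - enorm v <= enorm (u - v).
Proof. by rewrite lerBlDr -{1}[u](subrK v) enormD. Qed.

Lemma coord_le_enorm u i : `|u 0 i| <= enorm u.
Proof.
rewrite -ler_sqr ?nnegrE ?enorm_ge0 // sqr_enorm real_normK ?num_real //.
rewrite /dotv (bigD1 i) //= -expr2 lerDl.
by apply: sumr_ge0 => j _; rewrite -expr2 sqr_ge0.
Qed.

Lemma continuous_dotv {T : topologicalType} (f g : T -> 'rV[R]_n) :
  continuous f -> continuous g -> continuous (fun t => dotv (f t) (g t)).
Proof.
move=> cf cg t; apply: cvg_big => [|i _]; first exact: add_continuous.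
have coord (M : 'rV[R]_n) : {for M, continuous (fun N : 'rV[R]_n => N 0 i)}.
  exact: coord_continuous.
by apply: cvgM; [exact: continuous_cvg (coord _) (cf t)|
  exact: continuous_cvg (coord _) (cg t)].
Qed.

Lemma continuous_enorm {T : topologicalType} (f : T -> 'rV[R]_n) :
  continuous f -> continuous (fun t => enorm (f t)).
Proof.
move=> cf t.
exact: continuous_cvg (@sqrt_continuous R _) (continuous_dotv _ _ cf cf t).
Qed.

Lemma continuous_enormB u : continuous (fun v => enorm (v - u)).
Proof.
apply/continuous_enorm/continuous_addf; first exact: continuous_idf.
exact: continuous_cstf.
Qed.

Lemma nbhs_eball u r : 0 < r -> \forall v \near u, enorm (v - u) < r.
Proof.
move=> r0; apply: (cvgr_lt _ (continuous_enormB u u)).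
by rewrite subrr enorm0.
Qed.

Lemma nbhs_eballP u (A : set 'rV[R]_n) :
  nbhs u A <-> exists2 r, 0 < r & forall v, enorm (v - u) < r -> A v.
Proof.
split=> [/nbhs_ballP[r /= r0 rA]|[r r0 rA]]; last first.
  by apply: filterS (nbhs_eball u _ r0).
exists r => // v vr; apply: rA; split=> // i j.
rewrite /ball /= ord1 distrC; apply: le_lt_trans vr.
by have := coord_le_enorm (v - u) j; rewrite !mxE.
Qed.

Lemma compact_eball u r : compact [set v | enorm (v - u) <= r].
Proof.
have cB : compact [set v : 'rV[R]_n |
    forall i, `[u 0 i - r, u 0 i + r]%classic (v ord0 i)].
  apply: (@rV_compact R n (fun i => `[u 0 i - r, u 0 i + r]%classic)) => i.
  exact: segment_compact.
apply: subclosed_compact cB _.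
  apply: (@preimage_closed _ _ (fun v => enorm (v - u)) [set x | x <= r]).
    by move=> v _; exact: continuous_enormB.
  exact: closed_le.
move=> v /= vr i; have := le_trans (coord_le_enorm (v - u) i) vr.
by rewrite !mxE ler_distl in_itv.
Qed.

End Euclid.

Ltac continuity_step := lazymatch goal with
  | |- continuous (fun _ => _ + _) => apply: continuous_addf
  | |- continuous (fun _ => - _) => apply: continuous_oppf
  | |- continuous (fun _ => _ * _) => apply: continuous_mulf
  | |- continuous (fun _ => `|_|) => apply: continuous_normf
  | |- continuous (fun _ => _ ^+ _) => apply: continuous_exprf
  | |- continuous (fun _ => dotv _ _) => apply: continuous_dotv
  | |- continuous (fun _ => enorm _) => apply: continuous_enorm
  | |- continuous (fun _ => _.1) => apply: continuous_fstf
  | |- continuous (fun _ => _.2) => apply: continuous_sndf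
  | |- continuous fst => exact: (continuous_fstf _ continuous_idf)
  | |- continuous snd => exact: (continuous_sndf _ continuous_idf)
  | |- continuous (fun t => t) => exact: continuous_idf
  | |- continuous (fun _ => _) => exact: continuous_cstf
  end.
Ltac continuity := repeat continuity_step.

(** * Penalisation on compact sets *)

(** Where [psi] vanishes, [phi] exceeds [phi c0] away from [c0]; where [psi] is
    positive, a large multiple of it makes up for any deficit of [phi]. By
    compactness one multiple does so on all of [K] outside [U], so a minimiser
    of [phi + j * psi] lies in [U]. *)
Lemma compact_penalty {R : realType} {T : topologicalType} (K : set T)
    (phi psi : T -> R) (c0 : T) (U : set T) :
  compact K -> continuous phi -> continuous psi -> K c0 ->
  (forall c, 0 <= psi c) -> psi c0 = 0 ->
  (forall c, K c -> psi c = 0 -> phi c <= phi c0 -> c = c0) ->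
  nbhs c0 U ->
  exists2 j : R, 0 < j & exists c, [/\ K c, U c &
    forall c', K c' -> phi c + j * psi c <= phi c' + j * psi c'].
Proof.
move=> cK cphi cpsi Kc0 psi0 psic0 strict Uc0.
pose P (i : nat) x := U x \/ phi c0 < phi x + i.+1%:R * psi x.
suff [N _ NP] : \forall i \near \oo, K `<=` P i; last first.
  apply: ((compact_near_coveringP K).1 cK) => x Kx.
  have [Ux|nUx] := pselect (nbhs x U).
    exists (U, setT) => [|[y i] [/= Uy _]]; last by left.
    by split=> //; exact: filterT.
  have [h|h] := ltP (phi c0) (phi x).
    exists ([set y | phi c0 < phi y], setT) => [|[y i] [/= hy _]].
      by split; [exact: (cvgr_gt _ (cphi x))|exact: filterT].
    by right; apply: ltr_wpDr => //; rewrite mulr_ge0.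
  have px : 0 < psi x.
    rewrite lt_neqAle psi0 andbT eq_sym; apply/eqP => px.
    by apply: nUx; rewrite (strict x).
  exists ([set y | psi x / 2 < psi y] `&` [set y | phi x - 1 < phi y],
      [set i | (phi c0 - phi x + 1) / (psi x / 2) < i%:R]).
    split; last exact: nbhs_infty_gtr.
    apply: filterI; last by apply: (cvgr_gt _ (cphi x)); lra.
    by apply: (cvgr_gt _ (cpsi x)); lra.
  move=> [y i] [/= [h1 h2] h3]; right.
  move: h3; rewrite ltr_pdivrMr ?divr_gt0 // => h3.
  have i0 : 0 <= i%:R :> R by [].
  rewrite -natr1; nra.
have [c cK' cmin] := @compact_EVT_min T R
  (fun x => phi x + N.+1%:R * psi x) K (ex_intro _ _ Kc0) cK
  (continuous_subspaceT (continuous_addf _ _ cphi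
     (continuous_mulf _ _ (continuous_cstf _) cpsi))).
have Kc := set_mem cK'.
exists N.+1%:R => //; exists c; split=> // [|c' /mem_set/cmin //].
have [//|] := NP N (leqnn N) c Kc.
by have := cmin _ (mem_set Kc0); rewrite /= psic0; lra.
Qed.

Section Epigraphs.
Context {R : realType} {n : nat}.
Implicit Types (h : 'rV[R]_n -> \bar R) (x u v : 'rV[R]_n).

Lemma closed_epigraph h : lower_semicontinuous h ->
  closed [set p : 'rV[R]_n * R | (h p.1 <= p.2%:E)%E].
Proof.
move=> lsc; rewrite -openC openE => -[x a] /= /negP; rewrite -ltNge => ah.
have [b ab bh] : exists2 b, a < b & (b%:E < h x)%E.
  case: (h x) ah => [r|_|//]; last by exists (a + 1); rewrite ?ltry //; lra.
  by rewrite lte_fin => ar; exists ((a + r) / 2); rewrite ?lte_fin; lra.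
have [V Vx Vh] := lsc _ _ bh.
exists (V, [set c | c < b]) => [|[y c] /= [Vy cb]].
  by split=> //=; exact: (cvgr_lt _ (fun A => id)).
by apply/negP; rewrite -ltNge (le_lt_trans _ (Vh _ Vy)) // lee_fin ltW.
Qed.

Lemma closed_sublevel h (a : R) : lower_semicontinuous h ->
  closed [set x | (h x <= a%:E)%E].
Proof.
move=> /lower_semicontinuousP/(_ a) oh.
rewrite (_ : [set x | _] = ~` [set x | (a%:E < h x)%E]).
  exact: open_closedC.
by apply/seteqP; split=> x /=; rewrite ltNge; [move=> ->|move=> /negP/negPn].
Qed.

End Epigraphs.

(** * Fréchet normals to epigraphs *)

Lemma frechet_normalP {R : realType} {d : nat} (C : set 'rV[R]_d) x v :
  frechet_normal C x v <-> forall e, 0 < e ->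
    \forall y \near x, C y -> dotv v (y - x) <= e * enorm (y - x).
Proof.
have pos (y : 'rV[R]_d) : y != x -> 0 < enorm (y - x).
  by move=> yx; rewrite enorm_gt0 // subr_eq0.
split=> [nv e e0|nv].
  have := e0; rewrite -lte_fin => /(le_lt_trans nv)/ereal_inf_lt[_ [V FV <-]].
  have {}FV : \forall y \near x, y != x -> C y -> V y by exact: FV.
  move=> supV; apply: filterS FV => y yV Cy.
  have [->|yx] := eqVneq y x; first by rewrite subrr dotvC dotv0l enorm0 mulr0.
  rewrite -ler_pdivrMr ?pos //; rewrite -lee_fin.
  apply: le_trans (ltW supV); apply: ereal_sup_ubound.
  by exists y => //; exact: yV.
apply/lee_addgt0Pr => e e0; rewrite add0e.
apply: ge_ereal_inf; exists (ereal_sup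
  ((fun y => (dotv v (y - x) / enorm (y - x))%:E) @`
     [set y | y != x /\ dotv v (y - x) <= e * enorm (y - x)])).
  eexists; last reflexivity.
  by apply: filterS (nv e e0) => y h yx Cy; split=> //; exact: h.
apply: ge_ereal_sup => _ [y [yx h] <-].
by rewrite lee_fin ler_pdivrMr ?pos.
Qed.

Section EpiNormals.
Context {R : realType} {n : nat}.
Implicit Types (h : 'rV[R]_n -> \bar R) (x z u v : 'rV[R]_n) (a c t e r : R).

Lemma pairvB x z a c : pairv x a - pairv z c = pairv (x - z) (a - c).
Proof.
rewrite /pairv opp_row_mx add_row_mx; congr row_mx.
by apply/rowP => i; rewrite !mxE.
Qed.

Lemma pairvK (w : 'rV[R]_(n + 1)) : pairv (lsubmx w) (rsubmx w 0 0) = w.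
Proof.
rewrite -[RHS]hsubmxK; congr row_mx.
by apply/rowP => i; rewrite !mxE ord1.
Qed.

Lemma dotv_pairv x z a c : dotv (pairv x a) (pairv z c) = dotv x z + a * c.
Proof.
rewrite /dotv big_split_ord /=; congr (_ + _).
  by apply: eq_bigr => i _; rewrite !row_mxEl.
by rewrite big_ord1 !row_mxEr !mxE.
Qed.

Lemma enorm_pairv_le x a : enorm (pairv x a) <= enorm x + `|a|.
Proof.
rewrite -ler_sqr ?nnegrE ?addr_ge0 ?enorm_ge0 // sqr_enorm dotv_pairv.
have := enorm_ge0 x; have := normr_ge0 a.
rewrite sqrrD real_normK ?num_real // sqr_enorm; nra.
Qed.

Lemma enorm_le_pairv x a : enorm x <= enorm (pairv x a).
Proof.
rewrite -ler_sqr ?nnegrE ?enorm_ge0 // !sqr_enorm dotv_pairv -expr2.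
by rewrite lerDl sqr_ge0.
Qed.

Lemma abs_le_pairv x a : `|a| <= enorm (pairv x a).
Proof.
rewrite -ler_sqr ?nnegrE ?enorm_ge0 // !sqr_enorm dotv_pairv -expr2.
by rewrite real_normK ?num_real // lerDr dotv_ge0.
Qed.

(** Fréchet normality of [(u, t)] to the epigraph of [h] at [(x, a)], with the
    equivalent norm [|x| + |a|] on the product in place of the Euclidean one. *)
Definition epi_normal h x a u t : Prop :=
  forall e, 0 < e -> exists2 r, 0 < r & forall z c, (h z <= c%:E)%E ->
    enorm (z - x) < r -> `|c - a| < r ->
    dotv u (z - x) + t * (c - a) <= e * (enorm (z - x) + `|c - a|).

Lemma frechet_epiP h x a u t :
  frechet_normal (epi h) (pairv x a) (pairv u t) <-> epi_normal h x a u t.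
Proof.
rewrite frechet_normalP; split=> N e e0.
  have /nbhs_eballP[r r0 rN] := N e e0.
  exists (r / 2) => [|z c hzc zr cr]; first lra.
  have := rN (pairv z c); rewrite pairvB dotv_pairv => rN'.
  have le := enorm_pairv_le (z - x) (c - a).
  apply: le_trans (rN' _ _) _; [lra|by exists (z, c)|].
  by rewrite ler_pM2l.
have [|r r0 rN] := N (e / 2); first lra.
apply/nbhs_eballP; exists r => // y yr [[z c] /= hzc yE]; move: yr; rewrite -yE.
rewrite pairvB dotv_pairv => zcr.
have le1 := enorm_le_pairv (z - x) (c - a).
have le2 := abs_le_pairv (z - x) (c - a).
apply: le_trans (rN z c hzc _ _) _; [lra|lra|nra].
Qed.

(** An epigraph contains its upward translates, so a normal at a point above
    the graph is also a normal at the point of the graph below it. *)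
Lemma epi_normal_graph h x a u t : h x != -oo%E -> (h x <= a%:E)%E ->
  epi_normal h x a u t -> epi_normal h x (fine (h x)) u t.
Proof.
case E : (h x) => [b| |] // _; rewrite lee_fin => ba N e e0.
have [r r0 rN] := N e e0; exists r => // z c hzc zr cr.
have e1 : c + (a - b) - a = c - b by ring.
have := rN z (c + (a - b)); rewrite e1; apply=> //.
by apply: le_trans hzc _; rewrite lee_fin; lra.
Qed.

(** A normal at infinity is approximated by Fréchet normals at far points of
    the epigraph, whether on its graph or above it. *)
Lemma normal_inftyP h u t : (forall x, h x != -oo%E) ->
  normal_infty h (pairv u t) <-> forall e, 0 < e -> exists x a v c,
    [/\ (h x <= a%:E)%E, e^-1 < enorm x, epi_normal h x a v c,
        enorm (v - u) < e & `|c - t| < e].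
Proof.
move=> hN; split=> [[x_ [w_ [xdom xoo wN wu]]] e e0|H].
  have e20 : 0 < e / 2 by lra.
  have n1 : \forall k \near \oo, enorm (w_ k - pairv u t) < e / 2.
    exact: (wu _ (nbhs_eball _ _ e20)).
  have n2 : \forall k \near \oo, e^-1 + 1 < enorm (x_ k).
    by move/cvgryPgt : xoo; exact.
  have [k [k1 k2]] : exists k, enorm (w_ k - pairv u t) < e / 2 /\
      e^-1 + 1 < enorm (x_ k).
    exact: filter_ex (filterI n1 n2).
  have [y_ [v_ [yE yx vN vw]]] := wN k.
  have m1 : \forall i \near \oo, enorm (v_ i - w_ k) < e / 2.
    exact: (vw _ (nbhs_eball _ _ e20)).
  have m2 : \forall i \near \oo,
      enorm (y_ i - pairv (x_ k) (fine (h (x_ k)))) < 1.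
    exact: (yx _ (nbhs_eball _ _ ltr01)).
  have [i [i1 i2]] : exists i, enorm (v_ i - w_ k) < e / 2 /\
      enorm (y_ i - pairv (x_ k) (fine (h (x_ k)))) < 1.
    exact: filter_ex (filterI m1 m2).
  have [[x a] /= hxa yixa] := yE i.
  have := vN i; rewrite -yixa -(pairvK (v_ i)) frechet_epiP => N.
  exists x, a, (lsubmx (v_ i)), (rsubmx (v_ i) 0 0).
  have vu := enorm_distD (v_ i) (w_ k) (pairv u t).
  move: vu i2; rewrite -yixa -{1}(pairvK (v_ i)) !pairvB => vu i2.
  have g1 := enorm_le_pairv (lsubmx (v_ i) - u) (rsubmx (v_ i) 0 0 - t).
  have g2 := abs_le_pairv (lsubmx (v_ i) - u) (rsubmx (v_ i) 0 0 - t).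
  have g3 := enorm_le_pairv (x - x_ k) (a - fine (h (x_ k))).
  have g4 := enorm_lerB (x_ k) x; rewrite enormB in g4.
  by split=> //; lra.
have e_ k : 0 < (k.+1%:R : R)^-1 by rewrite invr_gt0.
have {H} /choice[F HF] : forall k : nat,
  exists p : 'rV[R]_n * R * ('rV[R]_n * R),
    [/\ (h p.1.1 <= p.1.2%:E)%E, k.+1%:R < enorm p.1.1,
        epi_normal h p.1.1 p.1.2 p.2.1 p.2.2,
        enorm (p.2.1 - u) < k.+1%:R^-1 & `|p.2.2 - t| < k.+1%:R^-1].
  move=> k; have [x [a [v [c]]]] := H _ (e_ k).
  by rewrite invrK => ?; exists (x, a, (v, c)).
have small (e : R) : 0 < e -> \forall k \near \oo, (k.+1%:R : R)^-1 < e.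
  move=> e0; have := nbhs_infty_gtr e^-1; apply: filterS => k ke.
  by rewrite invf_plt ?posrE // -natr1; lra.
exists (fun k => (F k).1.1), (fun k => pairv (F k).2.1 (F k).2.2); split.
- by move=> k; have [hk _ _ _ _] := HF k; exact: le_lt_trans hk (ltry _).
- apply/cvgryPgt => A; have := nbhs_infty_gtr A; apply: filterS => k kA.
  by have [_ hk _ _ _] := HF k; apply: lt_trans hk; rewrite -natr1; lra.
- move=> k; have [hk _ Nk _ _] := HF k.
  exists (fun=> pairv (F k).1.1 (fine (h (F k).1.1))),
    (fun=> pairv (F k).2.1 (F k).2.2); split.
  + move=> _; exists ((F k).1.1, fine (h (F k).1.1)) => //=.
    rewrite fineK // fin_numE hN /=; apply/negP => /eqP E.
    by move: hk; rewrite E leye_eq.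
  + exact: cvg_cst.
  + by move=> _; apply/frechet_epiP; exact: epi_normal_graph Nk.
  + exact: cvg_cst.
- move=> A /nbhs_eballP[r r0 rA].
  have := small (r / 2) (divr_gt0 r0 (ltr0Sn _ _)); apply: filterS => k kr.
  apply: rA; rewrite pairvB; apply: le_lt_trans (enorm_pairv_le _ _) _.
  have [_ _ _ /lt_trans/(_ kr) h1 /lt_trans/(_ kr) h2] := HF k.
  by rewrite (splitr r) ltrD.
Qed.

End EpiNormals.

(** * Decoupling by quadratic penalties *)

Section Decoupling.
Context {R : realType} {n : nat}.
Implicit Types (f g h : 'rV[R]_n -> \bar R) (S : set 'rV[R]_n).
Implicit Types (a p u v w x y z : 'rV[R]_n) (b c t e r : R).

(** A local minimiser on the epigraph of a quadratic function satisfies such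
    an inequality, [(u, t)] being minus the gradient. *)
Lemma epi_normal_quadratic h x b u t (L r : R) : 0 < r ->
  (forall z c, (h z <= c%:E)%E -> enorm (z - x) < r -> `|c - b| < r ->
    dotv u (z - x) + t * (c - b) <=
      L * (dotv (z - x) (z - x) + (c - b) ^+ 2)) ->
  epi_normal h x b u t.
Proof.
move=> r0 H e e0; have L0 : 0 < `|L| + 1 by rewrite ltr_wpDl.
have q0 : 0 < e / (`|L| + 1) by rewrite divr_gt0.
exists (Num.min r (e / (`|L| + 1))); first by rewrite lt_min r0.
move=> z c hzc; rewrite !lt_min => /andP[zr ze] /andP[cr ce].
apply: le_trans (H z c hzc zr cr) _.
rewrite -sqr_enorm -(real_normK (num_real (c - b))).
move: ze ce; rewrite !ltr_pdivlMr //.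
have := ler_norm L; have := enorm_ge0 (z - x); have := normr_ge0 (c - b).
move: (enorm (z - x)) `|c - b| (`|L|) L0 => X Y l L0 Y0 X0 Ll Xe Ye.
have h1 : X * (X * (l + 1)) <= X * e by rewrite ler_wpM2l // ltW.
have h2 : Y * (Y * (l + 1)) <= Y * e by rewrite ler_wpM2l // ltW.
have h3 : L * (X ^+ 2 + Y ^+ 2) <= (l + 1) * (X ^+ 2 + Y ^+ 2).
  by rewrite ler_wpM2r ?addr_ge0 ?sqr_ge0 //; lra.
by apply: le_trans h3 _; lra.
Qed.

Lemma compact_epi_box h x b r : lower_semicontinuous h ->
  compact [set q : 'rV[R]_n * R |
    [/\ (h q.1 <= q.2%:E)%E, enorm (q.1 - x) <= r & `|q.2 - b| <= r]].
Proof.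
move=> lsc; rewrite (_ : [set q | _] =
  ([set v | enorm (v - x) <= r] `*` `[b - r, b + r]%classic) `&`
  [set q | (h q.1 <= q.2%:E)%E]).
  apply: compact_closedI (closed_epigraph _ lsc).
  by apply: compact_setX; [exact: compact_eball|exact: segment_compact].
apply/seteqP; split=> -[z c] /=; rewrite in_itv /= -ler_distl.
  by case.
by case=> -[].
Qed.

(** The penalty [j * |a - p|^2] replaces the constraint that one point
    minimises [f] over [S]: a point [a] carries [f] and a point [p] carries
    [S]. The remaining quadratic terms force both to converge to [y] and make
    [p] a nearest point of [S] to [a]. *)
Lemma decoupled_minimizer f S x y b e : lower_semicontinuous f -> closed S ->
  S y -> f y = b%:E ->
  (forall z c, S z -> (f z <= c%:E)%E ->
    b + dotv (y - x) (y - x) <= c + dotv (z - x) (z - x)) ->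
  0 < e ->
  exists a c p (j : R), [/\ [/\ 0 < j, (f a <= c%:E)%E & S p],
    [/\ enorm (a - y) < e, `|c - b| < e & enorm (p - y) < e],
    forall z, S z -> enorm (a - p) <= enorm (a - z) &
    epi_normal f a c (- (2 *: (a - x) + 2 *: (a - y) + (2 * j) *: (a - p)))
      (- (1 + 2 * (c - b)))].
Proof.
move=> lsc clS Sy fy ymin e0.
(* With a and p within 1/4 of y, a point of S outside the unit ball around y is
   at distance at least 3/4 from a, hence farther from a than p is. *)
pose eta := Num.min e (1 / 4).
have eta0 : 0 < eta by rewrite lt_min e0; lra.
have [eta_e eta4] : eta <= e /\ eta <= 1 / 4.
  by split; rewrite ge_min lexx ?orbT.
pose K := [set q : 'rV[R]_n * R | [/\ (f q.1 <= q.2%:E)%E, enorm (q.1 - y) <= 1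
  & `|q.2 - b| <= 1]] `*` ([set p | enorm (p - y) <= 1] `&` S).
pose phi (q : 'rV[R]_n * R * 'rV[R]_n) := q.1.2
  + dotv (q.1.1 - x) (q.1.1 - x) + dotv (q.1.1 - y) (q.1.1 - y)
  + (q.1.2 - b) ^+ 2.
pose psi (q : 'rV[R]_n * R * 'rV[R]_n) := dotv (q.1.1 - q.2) (q.1.1 - q.2).
pose U := [set q : 'rV[R]_n * R * 'rV[R]_n |
  [/\ enorm (q.1.1 - y) < eta, `|q.1.2 - b| < eta & enorm (q.2 - y) < eta]].
have [||||||||j j0 [[[a c] p] [[/= [fac ay cb] [py Sp]] [/= ay' cb' py'] cmin]]]
    := @compact_penalty R _ K phi psi ((y, b), y) U.
- apply: compact_setX; first exact: compact_epi_box.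
  by apply: compact_closedI clS; exact: compact_eball.
- by rewrite /phi; continuity.
- by rewrite /psi; continuity.
- by split; split; rewrite /= ?subrr ?enorm0 ?normr0 ?fy.
- by move=> q; exact: dotv_ge0.
- by rewrite /psi /= subrr dotv0l.
- move=> [[z c] p] [/= [fzc _ _] [_ Sp]]; rewrite /psi /phi /= => h0 hle.
  have zp : z = p by exact: dotvB_eq0.
  have h1 : b + dotv (y - x) (y - x) <= c + dotv (z - x) (z - x).
    by apply: ymin => //; rewrite zp.
  move: hle; rewrite subrr dotv0l => hle.
  have h2 := dotv_ge0 (z - y); have h3 := sqr_ge0 (c - b).
  have zy : z = y by apply: dotvB_eq0; lra.
  have cb : (c - b) ^+ 2 = 0 by lra.
  by move/eqP: cb; rewrite sqrf_eq0 subr_eq0 => /eqP ->; rewrite -zp zy.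
- exists ([set q | enorm (q.1 - y) < eta /\ `|q.2 - b| < eta],
    [set p | enorm (p - y) < eta]) => [|[[z c] p] [/= [? ?] ?] //].
  split; last exact: nbhs_eball.
  exists ([set z | enorm (z - y) < eta], [set c | `|c - b| < eta]).
    split; first exact: nbhs_eball.
    apply/nbhs_ballP; exists eta => // c; rewrite /ball /= distrC.
    exact.
  by move=> [z c] [].
exists a, c, p, j; split=> //; first by split; apply: lt_le_trans eta_e.
  move=> z Sz; have [zy|zy] := leP (enorm (z - y)) 1.
    have := cmin ((a, c), z); rewrite /phi /psi /= => /(_ (conj (And3 fac ay cb)
      (conj zy Sz))); rewrite lerD2l ler_pM2l // -!sqr_enorm.
    by rewrite ler_sqr ?nnegrE ?enorm_ge0.
  have h1 := enorm_distD z a y; have h2 := enorm_distD a y p.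
  rewrite (enormB z a) in h1; rewrite (enormB y p) in h2; lra.
apply: (@epi_normal_quadratic _ _ _ _ _ (2 + j) (1 / 4)); first lra.
move=> z d fzd za dc.
have := cmin ((z, d), p); rewrite /phi /psi /=.
have zK : K ((z, d), p).
  split; split=> //=; first by have := enorm_distD z a y; lra.
  by have := ler_distD c d b; lra.
rewrite (dotv_shift x a z) (dotv_shift y a z) (dotv_shift p a z) => /(_ zK).
have uE (A B C k : 'rV[R]_n) : dotv (- (2 *: A + 2 *: B + (2 * j) *: C)) k =
    - (2 * dotv A k + 2 * dotv B k + 2 * j * dotv C k).
  by rewrite !dotv_lin.
rewrite uE; have := sqr_ge0 (d - c).
have := mulr_ge0 (ltW j0) (sqr_ge0 (d - c)).
lra.
Qed.
End Decoupling.

Section ErrorBound.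
Context {R : realType} {n : nat}.
Implicit Types (g : 'rV[R]_n -> \bar R) (S : set 'rV[R]_n).
Implicit Types (a p u v w x y z : 'rV[R]_n) (b c t e r : R).

(** Near a nearest point [p] of [S] to [a], the error bound turns
    [|z - a| + d(z; S) >= |p - a|] into a lower bound in terms of [g]. *)
Lemma error_bound_penalty g S (alpha r : R) a p z c : 0 < alpha ->
  (forall x, r < enorm x -> (Defs.edist x S <= alpha%:E * maxe (g x) 0)%E) ->
  (forall y, S y -> enorm (a - p) <= enorm (a - y)) ->
  r < enorm z -> (g z <= c%:E)%E ->
  enorm (a - p) <= enorm (z - a) + alpha * ((c + `|c|) / 2).
Proof.
move=> alpha0 eb pa rz gzc.
have h1 : ((enorm (a - p) - enorm (z - a))%:E <= Defs.edist z S)%E.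
  apply: le_ereal_inf_tmp => _ [y Sy <-]; rewrite lee_fin.
  have := pa y Sy; have := enorm_distD a z y.
  by rewrite (enormB a z) (enormB z y); lra.
have h2 : (maxe (g z) 0 <= ((c + `|c|) / 2)%:E)%E.
  rewrite ge_max lee_fin; have h := ler_norm c; have h' := ler_norm (- c).
  rewrite normrN in h'; apply/andP; split; last by lra.
  by apply: le_trans gzc _; rewrite lee_fin; lra.
have a0 : (0 <= alpha%:E)%E by rewrite lee_fin ltW.
have := le_trans h1 (le_trans (eb z rz) (lee_wpmul2l a0 h2)).
by rewrite -EFinM lee_fin; lra.
Qed.

(** At a minimiser of [M] times the positive part plus a quadratic, the slope of
    the quadratic is opposite to a slope of the former, up to the second order
    term. *)
Lemma positive_part_slope (M i c s tau : R) : 0 <= M -> 0 < tau ->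
  (forall s1, `|s1 - s| <= tau ->
    M * ((s + `|s|) / 2) + i * (s - c) ^+ 2 <=
    M * ((s1 + `|s1|) / 2) + i * (s1 - c) ^+ 2) ->
  - (i * tau) <= 2 * i * (c - s) <= M + i * tau.
Proof.
move=> M0 tau0 smin; have ttau : `|tau| <= tau by rewrite gtr0_norm.
have := smin (s - tau); rewrite addrAC subrr add0r normrN => /(_ ttau) h1.
have := smin (s + tau); rewrite addrAC subrr add0r => /(_ ttau) h2.
have k1 : s - tau + `|s - tau| <= s + `|s|.
  by clear -tau0; case: (ler0P (s - tau)); case: (ler0P s); lra.
have k2 : s + tau + `|s + tau| <= s + `|s| + 2 * tau.
  by have := ler_normD s tau; lra.
have := ler_wpM2l M0 k1; have := ler_wpM2l M0 k2 => k2' k1'.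
by apply/andP; split; rewrite -(ler_pM2r tau0); lra.
Qed.

(** The multiplier [t] is controlled by the length of the proximal normal
    [2 j (a - p)] to [S] because the penalty parameter of [g] is. The variable
    [s] smooths the positive part: it is tied to the height [c] by the
    quadratic [i * (s - c)^2] alone. *)
Lemma proximal_normal_error_bound g S (alpha r : R) a p (j e : R) :
  lower_semicontinuous g -> 0 < alpha ->
  (forall x, r < enorm x -> (Defs.edist x S <= alpha%:E * maxe (g x) 0)%E) ->
  (forall y, S y -> enorm (a - p) <= enorm (a - y)) ->
  (g p <= 0)%E -> r + 1 < enorm p -> 0 < j -> 0 < e ->
  exists z c w t, [/\ (g z <= c%:E)%E, enorm (z - p) < e,
    epi_normal g z c w (- t), enorm (w - (2 * j) *: (a - p)) < e &
    - e < t < alpha * enorm ((2 * j) *: (a - p)) + e].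
Proof.
move=> lsc alpha0 eb pa gp rp j0 e0.
(* In the end w differs from 2 j (a - p) by (2 j + 2) (z - p), and t exceeds
   its bounds by at most 2 |c| + e / 4. *)
pose eta := Num.min (1 / 4) (e / (2 * j + 8)).
have e'0 : 0 < e / (2 * j + 8) by rewrite divr_gt0 //; lra.
have eta0 : 0 < eta by rewrite lt_min e'0; lra.
have eta4 : eta <= 1 / 4 by rewrite ge_min lexx.
have eta_e : eta * (2 * j + 8) <= e.
  by rewrite -ler_pdivlMr ?ge_min ?lexx ?orbT //; lra.
pose delta := enorm (a - p); have delta0 : 0 <= delta by exact: enorm_ge0.
(* j |z - a|^2 + 2 j delta (delta - |z - a|) >= j delta^2: the factor
   2 j delta makes the error bound an exact penalty for j |z - a|^2. *)
pose M := 2 * j * delta * alpha.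
have M0 : 0 <= M by rewrite !mulr_ge0 // ltW.
pose K := [set q : 'rV[R]_n * R | [/\ (g q.1 <= q.2%:E)%E, enorm (q.1 - p) <= 1
  & `|q.2 - 0| <= 1]] `*` `[-1, 1 : R]%classic.
pose phi (q : 'rV[R]_n * R * R) := j * dotv (q.1.1 - a) (q.1.1 - a)
  + dotv (q.1.1 - p) (q.1.1 - p) + q.1.2 ^+ 2 + M * ((q.2 + `|q.2|) / 2).
pose psi (q : 'rV[R]_n * R * R) := (q.2 - q.1.2) ^+ 2.
pose U := [set q : 'rV[R]_n * R * R |
  [/\ enorm (q.1.1 - p) < eta, `|q.1.2| < eta & `|q.2| < eta]].
have [||||||||i i0 [[[z c] s] [[/= [gzc _ _] _] [/= zp' c' s'] cmin]]]
    := @compact_penalty R _ K phi psi ((p, 0), 0) U.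
- by apply: compact_setX; [exact: compact_epi_box|exact: segment_compact].
- by rewrite /phi; continuity.
- by rewrite /psi; continuity.
- split; first by split; rewrite /= ?subrr ?enorm0 ?normr0.
  by rewrite /= in_itv /=; lra.
- by move=> q; exact: sqr_ge0.
- by rewrite /psi /= subrr expr0n.
- move=> [[z c] s] [/= [gzc zp _] _]; rewrite /psi /phi /= => /eqP.
  rewrite sqrf_eq0 subr_eq0 => /eqP ->.
  have rz : r < enorm z.
    by have := enorm_lerB p z; rewrite enormB; lra.
  have := error_bound_penalty _ _ _ _ _ _ _ _ alpha0 eb pa rz gzc.
  rewrite -/delta subrr dotv0l normr0 -!sqr_enorm (enormB p a) -/delta.
  set X := enorm (z - a); set Y := _ / 2 => XY.
  have h1 := mulr_ge0 (ltW j0) (sqr_ge0 (X - delta)).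
  have h2 : 0 <= 2 * j * delta * (X + alpha * Y - delta).
    by rewrite !mulr_ge0 ?subr_ge0 // ltW.
  rewrite /M => hle.
  have h3 := sqr_ge0 (enorm (z - p)); have h4 := sqr_ge0 c.
  have : enorm (z - p) ^+ 2 = 0 by lra.
  move/eqP; rewrite sqrf_eq0 => /eqP/enorm_eq0/eqP; rewrite subr_eq0 => /eqP ->.
  have : c ^+ 2 = 0 by lra.
  by move/eqP; rewrite sqrf_eq0 => /eqP ->.
- have near0 : nbhs (0 : R) [set c | `|c| < eta].
    by apply/nbhs_ballP; exists eta => // c; rewrite /ball /= sub0r normrN.
  exists ([set q | enorm (q.1 - p) < eta /\ `|q.2| < eta],
    [set s | `|s| < eta]) => [|[[z c] s] [/= [? ?] ?] //].
  split=> //; exists ([set z | enorm (z - p) < eta], [set c | `|c| < eta]).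
    by split=> //; exact: nbhs_eball.
  by move=> [z c] [].
pose w := - ((2 * j) *: (z - a) + 2 *: (z - p)).
pose q := 2 * i * (c - s).
have qP tau : 0 < tau -> tau <= 1 / 4 -> - (i * tau) <= q <= M + i * tau.
  move=> tau0 tau4; apply: positive_part_slope => // s1 ss1.
  have s1P : `|s1| <= 1 by have := ler_normD (s1 - s) s; rewrite subrK; lra.
  have := cmin ((z, c), s1); rewrite /phi /psi /= -!addrA !lerD2l.
  apply; split; last by rewrite /= in_itv /= -ler_norml.
  by split=> //=; rewrite ?subr0; lra.
have itau : exists2 tau, 0 < tau <= 1 / 4 & i * tau <= e / 4.
  exists (Num.min (1 / 4) (e / (4 * i))).
    apply/andP; split; last by rewrite ge_min lexx.
    by rewrite lt_min !divr_gt0 ?mulr_gt0.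
  rewrite mulrC -ler_pdivlMr // ge_min; apply/orP; right.
  by rewrite invfM; lra.
have {itau qP} /andP[q0 qM] : - (e / 4) <= q <= M + e / 4.
  have [tau /andP[t0 t4] ti] := itau; have /andP[] := qP _ t0 t4.
  by move=> h1 h2; apply/andP; split; lra.
exists z, c, w, (q + 2 * c); split=> //.
- apply: lt_le_trans zp' _; apply: le_trans eta_e.
  by rewrite ler_peMr; lra.
- apply: (@epi_normal_quadratic _ _ _ _ _ _ _ (j + i + 1) (1 / 4)); first lra.
  move=> z1 c1 gz1 zz1 cc1.
  have := cmin ((z1, c1), s); rewrite /phi /psi /=.
  have zK : K ((z1, c1), s).
    split; last by rewrite /= in_itv /= -ler_norml; lra.
    split=> //=; first by have := enorm_distD z1 z p; lra.
    by rewrite subr0; have := ler_normD (c1 - c) c; rewrite subrK; lra.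
  rewrite (dotv_shift a z z1) (dotv_shift p z z1) => /(_ zK).
  have wE (A B k : 'rV[R]_n) : dotv (- ((2 * j) *: A + 2 *: B)) k =
      - (2 * j * dotv A k + 2 * dotv B k).
    by rewrite !dotv_lin.
  rewrite wE /q; have := mulr_ge0 (ltW j0) (sqr_ge0 (c1 - c)).
  have := mulr_ge0 (ltW i0) (dotv_ge0 (z1 - z)).
  lra.
- rewrite (_ : _ - _ = - ((2 * j + 2) *: (z - p))).
    rewrite enormN enormZ ger0_norm; last lra.
    have : (2 * j + 2) * enorm (z - p) <= (2 * j + 2) * eta.
      by rewrite ler_wpM2l //; lra.
    lra.
  by rewrite /w; apply/rowP => k; rewrite !mxE; ring.
- rewrite enormZ ger0_norm -/delta; last lra.
  have := ler_norm c; have := ler_norm (- c); rewrite normrN => c1 c2.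
  have je : 0 < j * eta by rewrite mulr_gt0.
  have : M = alpha * (2 * j * delta) by rewrite /M; ring.
  by move=> ME; apply/andP; split; lra.
Qed.
End ErrorBound.

(** * Minimising points that escape to infinity *)

Section Minimising.
Context {R : realType} {n : nat}.
Implicit Types (f g : 'rV[R]_n -> \bar R) (S : set 'rV[R]_n).
Implicit Types (a p u v w x y z : 'rV[R]_n) (b c d t m e r : R).

Lemma compact_constrained_epi_box f S x b r :
  lower_semicontinuous f -> closed S ->
  compact [set q : 'rV[R]_n * R |
    [/\ (f q.1 <= q.2%:E)%E, enorm (q.1 - x) <= r, `|q.2 - b| <= r & S q.1]].
Proof.
move=> lsc clS; rewrite (_ : [set q | _] = [set q : 'rV[R]_n * R |
  [/\ (f q.1 <= q.2%:E)%E, enorm (q.1 - x) <= r & `|q.2 - b| <= r]] `&`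
  [set q | S q.1]).
  apply: compact_closedI; first exact: compact_epi_box.
  apply: (@preimage_closed _ _ (fun q : 'rV[R]_n * R => q.1) S) => // q _.
  exact: cvg_fst.
by apply/seteqP; split=> q /=; [case|case=> -[]].
Qed.

(** On the part of [S] in a ball, [f] has a minimum, which is above the
    unattained infimum. *)
Lemma near_minimisers_far f S m M : lower_semicontinuous f -> closed S ->
  (forall x, S x -> (m%:E <= f x)%E) -> (forall x, S x -> f x <> m%:E) ->
  exists2 d, 0 < d & forall y, S y -> (f y < (m + d)%:E)%E -> M < enorm y.
Proof.
move=> lsc clS fm fNm; pose r := Num.max M 1.
have [Mr r1] : M <= r /\ 1 <= r by split; rewrite le_max lexx ?orbT.
pose K := [set q : 'rV[R]_n * R | [/\ (f q.1 <= q.2%:E)%E, enorm (q.1 - 0) <= r,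
  `|q.2 - m| <= r & S q.1]].
have inK y c : S y -> f y = c%:E -> c <= m + 1 -> enorm y <= M -> K (y, c).
  move=> Sy fy cm yM; have := fm y Sy; rewrite fy lee_fin => mc.
  split=> //=; rewrite ?fy ?subr0 //; first exact: le_trans Mr.
  by rewrite ger0_norm ?subr_ge0 //; lra.
have fin y d : S y -> (f y < d%:E)%E -> exists2 c, f y = c%:E & c < d.
  move=> /fm; case: (f y) => // c _; rewrite lte_fin => cd.
  by exists c.
have [[q Kq]|K0] := pselect (K !=set0); last first.
  exists 1 => // y Sy /(fin _ _ Sy)[c fy cm]; have [//|yM] := ltP M (enorm y).
  by case: K0; exists (y, c); apply: inK => //; exact: ltW.
have cK : compact K by exact: compact_constrained_epi_box.
have [[y c] /set_mem[/= fyc _ _ Sy] cmin] := @compact_EVT_min _ R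
  (fun q : 'rV[R]_n * R => q.2) K (ex_intro _ _ Kq) cK
  (continuous_subspaceT (continuous_sndf _ continuous_idf)).
have mc : m < c.
  rewrite ltNge; apply/negP => cm; apply: (fNm y Sy).
  apply/eqP; rewrite eq_le fm // andbT; apply: le_trans fyc _.
  by rewrite lee_fin.
exists (Num.min 1 (c - m)); first by rewrite lt_min subr_gt0 mc ltr01.
move=> z Sz /(fin _ _ Sz)[d fz]; rewrite -ltrBlDl lt_min => /andP[d1 dc].
have [//|zM] := ltP M (enorm z).
have := cmin (z, d); rewrite /= => /(_ (mem_set (inK _ _ _ _ _ _))) h.
have : c <= d by apply: h => //; lra.
lra.
Qed.

Lemma prox_minimiser f S m x b : lower_semicontinuous f -> closed S ->
  (forall x, S x -> (m%:E <= f x)%E) -> S x -> f x = b%:E ->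
  exists y c, [/\ S y, f y = c%:E, c + dotv (y - x) (y - x) <= b &
    forall z d, S z -> (f z <= d%:E)%E ->
      c + dotv (y - x) (y - x) <= d + dotv (z - x) (z - x)].
Proof.
move=> lsc clS fm Sx fx; have mb : m <= b by have := fm x Sx; rewrite fx lee_fin.
pose r := b - m + 1.
pose K := [set q : 'rV[R]_n * R | [/\ (f q.1 <= q.2%:E)%E, enorm (q.1 - x) <= r,
  `|q.2 - b| <= r & S q.1]].
have cK : compact K by exact: compact_constrained_epi_box.
have Kx : K (x, b).
  by split=> //=; rewrite ?fx // subrr ?enorm0 ?normr0 /r; lra.
have cphi : continuous (fun q : 'rV[R]_n * R => q.2 + dotv (q.1 - x) (q.1 - x)).
  by continuity.
have [[y c] /set_mem[/= fyc yx cb Sy] cmin'] := @compact_EVT_min _ R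
  _ K (ex_intro _ _ Kx) cK (continuous_subspaceT cphi).
have cmin z d : K (z, d) ->
    c + dotv (y - x) (y - x) <= d + dotv (z - x) (z - x).
  by move=> Kz; exact: (cmin' _ (mem_set Kz)).
have := cmin x b Kx; rewrite subrr dotv0l addr0 => yb.
have [c' fy mc'] : exists2 c', f y = c'%:E & m <= c'.
  by have := fm y Sy; case: (f y) fyc => // c' _; rewrite lee_fin; exists c'.
have c'c : c' <= c by move: fyc; rewrite fy lee_fin.
have D0 := dotv_ge0 (y - x).
have cc' : c = c'.
  have := cmin y c'; have : K (y, c').
    by split=> //=; rewrite ?fy // distrC ger0_norm /r; lra.
  by move=> Ky /(_ Ky); lra.
exists y, c'; rewrite -cc'; split=> // [|z d Sz fzd]; first by rewrite cc'.
have md : m <= d by rewrite -lee_fin; exact: le_trans (fm z Sz) fzd.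
have Dz := dotv_ge0 (z - x).
have [db|bd] := leP d b; last by lra.
have [zr|zr] := leP (enorm (z - x)) r.
  by apply: cmin; split=> //=; rewrite distrC ger0_norm /r; lra.
move: Dz; rewrite -[dotv (z - x) _]sqr_enorm => Dz.
have : b - m <= enorm (z - x) ^+ 2 by rewrite /r in zr; nra.
lra.
Qed.

(** The minimiser [y] of [f + |. - x|^2] over [S] is itself nearly minimising,
    hence far, and the gradient of the perturbation is small because
    [|y - x|^2 <= f x - inf f]. *)
Lemma approximate_multipliers f g S (alpha r : R) : lower_semicontinuous f ->
  lower_semicontinuous g -> S = [set x | (g x <= 0)%E] ->
  dom f `&` S !=set0 -> (exists m, forall x, S x -> (m%:E <= f x)%E) ->
  ~ attains_inf f S -> 0 < alpha -> 0 < r ->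
  (forall x, r < enorm x -> (Defs.edist x S <= alpha%:E * maxe (g x) 0)%E) ->
  forall e, 0 < e -> exists x (a : R) u (s : R) z c w t,
    [/\ [/\ (f x <= a%:E)%E, e^-1 < enorm x & epi_normal f x a u (- s)],
        [/\ (g z <= c%:E)%E, e^-1 < enorm z & epi_normal g z c w (- t)],
        `|s - 1| < e, enorm (u + w) < e &
        - e < t < alpha * (enorm w + e) + e].
Proof.
move=> flsc glsc SE [x0 [fx0 Sx0]] [m0 fm0] Nattain alpha0 r0 eb e e0.
have clS : closed S by rewrite SE; exact: (closed_sublevel g 0).
have [m mE] : exists m, ereal_inf (f @` S) = m%:E.
  have : (m0%:E <= ereal_inf (f @` S))%E.
    by apply: le_ereal_inf_tmp => _ [x Sx <-]; exact: fm0.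
  have : (ereal_inf (f @` S) < +oo)%E.
    by apply: le_lt_trans fx0; apply: ereal_inf_lbound; exists x0.
  by case: (ereal_inf _) => // m _ _; exists m.
have fm x : S x -> (m%:E <= f x)%E.
  by move=> Sx; rewrite -mE; apply: ereal_inf_lbound; exists x.
have fNm x : S x -> f x <> m%:E.
  by move=> Sx fx; apply: Nattain; exists x; rewrite ?mE.
have ei0 : 0 < e^-1 by rewrite invr_gt0.
have [d d0 dfar] := near_minimisers_far _ _ _ (e^-1 + r + 3) flsc clS fm fNm.
(* d sends y to infinity, the square bounds |y - x| by e / 8. *)
pose d' := Num.min d ((e / 8) ^+ 2).
have d'0 : 0 < d' by rewrite lt_min d0 exprn_gt0 //; lra.
have [x [b [Sx fx bm]]] : exists x b, [/\ S x, f x = b%:E & b < m + d'].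
  have : (ereal_inf (f @` S) < (m + d')%:E)%E by rewrite mE lte_fin; lra.
  move=> /ereal_inf_lt[_ [x Sx <-]]; have := fm x Sx.
  by case E : (f x) => [b| |] //; rewrite lte_fin; exists x, b.
have [y [c [Sy fy yb ymin]]] := prox_minimiser _ _ _ _ _ flsc clS fm Sx fx.
have mc : m <= c by have := fm y Sy; rewrite fy lee_fin.
have d'd : d' <= d by rewrite ge_min lexx.
have d'e : d' <= (e / 8) ^+ 2 by rewrite ge_min lexx orbT.
have yfar : e^-1 + r + 3 < enorm y.
  by apply: dfar => //; rewrite fy lte_fin; have := dotv_ge0 (y - x); lra.
have yx : enorm (y - x) < e / 8.
  rewrite -ltr_sqr ?nnegrE ?enorm_ge0 ?sqr_enorm //; lra.
pose eta := Num.min 1 (e / 8).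
have eta0 : 0 < eta by rewrite lt_min ltr01 /=; lra.
have eta1 : eta <= 1 by rewrite ge_min lexx.
have eta_e : eta <= e / 8 by rewrite ge_min lexx orbT.
have [a [rho [p [j [[j0 farho Sp] [ay rhoc py] pa N]]]]] :=
  decoupled_minimizer _ _ _ _ _ _ flsc clS Sy fy ymin eta0.
have pfar : enorm y - eta < enorm p.
  by have := enorm_lerB y p; rewrite enormB; lra.
have afar : enorm y - eta < enorm a.
  by have := enorm_lerB y a; rewrite enormB; lra.
have gp : (g p <= 0)%E by move: Sp; rewrite SE.
have pr : r + 1 < enorm p by lra.
have [z [c' [w [t [gzc zp Nw wv /andP[t0 t1]]]]]] :=
  proximal_normal_error_bound _ _ _ _ _ _ _ _ glsc alpha0 eb pa gp pr j0 eta0.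
set v := (2 * j) *: (a - p) in N wv t1.
exists a, rho, (- (2 *: (a - x) + 2 *: (a - y) + v)), (1 + 2 * (rho - c)).
exists z, c', w, t; split.
- by split=> //; lra.
- by split=> //; have := enorm_lerB p z; rewrite enormB; lra.
- rewrite (_ : _ - 1 = 2 * (rho - c)); last by ring.
  rewrite normrM (ger0_norm (ler0n _ 2)). lra.
- rewrite (_ : _ + w = (w - v) - 2 *: (a - x) - 2 *: (a - y)); last first.
    by apply/rowP => k; rewrite !mxE; ring.
  have h1 := enormD (w - v - 2 *: (a - x)) (- (2 *: (a - y))).
  have h2 := enormD (w - v) (- (2 *: (a - x))).
  rewrite !enormN !enormZ !ger0_norm // in h1 h2.
  have := enorm_distD a y x; lra.
- have : enorm v <= enorm w + eta.
    by have := enorm_lerB v w; rewrite enormB; lra.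
  move=> /(ler_wpM2l (ltW alpha0)) h; apply/andP; split; first lra.
  have : alpha * (enorm w + eta) <= alpha * (enorm w + e).
    by rewrite ler_wpM2l ?ltW //; lra.
  lra.
Qed.

End Minimising.

(** * Passage to the limit *)

(** Visiting each neighbourhood of [p] at arbitrarily large indices serves in
    place of a convergent subsequence. *)
Lemma compact_seq_cluster {T : topologicalType} (K : set T) (X : nat -> T) :
  compact K -> (forall k, K (X k)) ->
  exists p : T, forall (U : set T) N, nbhs p U -> exists2 k, (N <= k)%N & U (X k).
Proof.
move=> cK KX.
have [p [_ clp]] : (K `&` cluster (X k @[k --> \oo])) !=set0.
  by apply: cK; exists 0%N => // k _; exact: KX.
exists p => U N pU.
have [_ [[k Nk <-] Uk]] : [set X k | k in [set k | (N <= k)%N]] `&` U !=set0.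
  apply: clp => //; exists N => // k Nk; exists k => //.
by exists k.
Qed.

Lemma near_inv_succ {R : realType} (e : R) : 0 < e ->
  exists N, forall k, (N <= k)%N -> (k.+1%:R : R)^-1 < e.
Proof.
move=> e0; have [N _ NP] : \forall k \near \oo, e^-1 < k%:R :> R.
  exact: nbhs_infty_gtr.
exists N => k /NP /= ke; rewrite invf_plt ?posrE // -natr1; lra.
Qed.

Lemma cluster_le0 {R : realType} {T : topologicalType} (X : nat -> T) p
    (F : T -> R) :
  (forall (U : set T) N, nbhs p U -> exists2 k, (N <= k)%N & U (X k)) ->
  continuous F -> (forall k, F (X k) <= k.+1%:R^-1) -> F p <= 0.
Proof.
move=> clp cF FX; rewrite leNgt; apply/negP => Fp.
have [|N NP] := near_inv_succ (F p / 2); first lra.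
have [|k Nk /= Fk] := clp [set q | F p / 2 < F q] N.
  by apply: (cvgr_gt _ (cF p)); lra.
by have := lt_trans Fk (le_lt_trans (FX k) (NP k Nk)); rewrite ltxx.
Qed.

Section Limits.
Context {R : realType} {n : nat}.
Implicit Types (f g h : 'rV[R]_n -> \bar R).
Implicit Types (u v w x y z : 'rV[R]_n) (b c d s t e : R).

Lemma epi_normalZ h x b u t c : 0 < c -> epi_normal h x b u t ->
  epi_normal h x b (c *: u) (c * t).
Proof.
move=> c0 N e e0; have [|r r0 rN] := N (e / c); first by rewrite divr_gt0.
exists r => // z d hz zx db; rewrite dotvZl -mulrA -mulrDr.
have -> : e * (enorm (z - x) + `|d - b|) =
    c * (e / c * (enorm (z - x) + `|d - b|)).
  by rewrite !mulrA [c * e]mulrC mulfK // gt_eqF.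
by rewrite ler_pM2l // rN.
Qed.

Lemma normal_inftyZ h u t c : (forall x, h x != -oo%E) -> 0 < c ->
  normal_infty h (pairv u t) -> normal_infty h (pairv (c *: u) (c * t)).
Proof.
move=> hN c0; rewrite !normal_inftyP // => N e e0.
have e'0 : 0 < Num.min e (e / c) by rewrite lt_min e0 divr_gt0.
have [x [a [v [d [hx xe Nx vu dt]]]]] := N _ e'0.
exists x, a, (c *: v), (c * d); split=> //.
- apply: le_lt_trans xe; rewrite lef_pV2 ?posrE // ge_min lexx //.
- exact: epi_normalZ.
- rewrite -scalerBr enormZ gtr0_norm // mulrC -ltr_pdivlMr //.
  by apply: lt_le_trans vu _; rewrite ge_min lexx orbT.
- rewrite -mulrBr normrM gtr0_norm // mulrC -ltr_pdivlMr //.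
  by apply: lt_le_trans dt _; rewrite ge_min lexx orbT.
Qed.

Lemma cluster_normal_infty h (Y : nat -> 'rV[R]_n * R) (q : 'rV[R]_n * R) :
  (forall x, h x != -oo%E) ->
  (forall k, exists x (a : R), [/\ (h x <= a%:E)%E, k.+1%:R < enorm x &
     epi_normal h x a (Y k).1 (- (Y k).2)]) ->
  (forall U N, nbhs q U -> exists2 k, (N <= k)%N & U (Y k)) ->
  normal_infty h (pairv q.1 (- q.2)).
Proof.
move=> hN HY clq; apply/(normal_inftyP _ _ _ hN) => e e0.
have [N NP] := near_inv_succ e e0.
have qU : nbhs q ([set p : 'rV[R]_n * R | enorm (p.1 - q.1) < e] `&`
    [set p : 'rV[R]_n * R | `|p.2 - q.2| < e]).
  apply: filterI.
    apply: (near_continuous_lt (fun p : 'rV[R]_n * R => enorm (p.1 - q.1))).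
      by continuity.
    by rewrite subrr enorm0.
  apply: (near_continuous_lt (fun p : 'rV[R]_n * R => `|p.2 - q.2|)).
    by continuity.
  by rewrite subrr normr0.
have [k Nk [/= h1 h2]] := clq _ N qU.
have [x [a [hx xk N']]] := HY k.
exists x, a, (Y k).1, (- (Y k).2); split=> //.
  by apply: lt_trans xk; rewrite invf_plt ?posrE //; exact: NP.
by rewrite -opprD normrN.
Qed.

(** Dividing by [1 + |u|] keeps both normals bounded, the multiplier [t]
    included, and keeps the limit nonzero: [|u| + s = 1]. *)
Lemma normalised_multipliers f g (alpha : R) : (forall x, f x != -oo%E) ->
  (forall x, g x != -oo%E) -> 0 < alpha ->
  (forall e, 0 < e -> exists x (a : R) u (s : R) z c w t,
    [/\ [/\ (f x <= a%:E)%E, e^-1 < enorm x & epi_normal f x a u (- s)],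
        [/\ (g z <= c%:E)%E, e^-1 < enorm z & epi_normal g z c w (- t)],
        `|s - 1| < e, enorm (u + w) < e &
        - e < t < alpha * (enorm w + e) + e]) ->
  exists u s t, [/\ normal_infty f (pairv u (- s)),
    normal_infty g (pairv (- u) (- t)), 0 <= s, 0 <= t & enorm u + s = 1].
Proof.
move=> fN gN alpha0 H.
have H' (k : nat) : exists q : ('rV[R]_n * R) * ('rV[R]_n * R),
  [/\ exists x a, [/\ (f x <= a%:E)%E, k.+1%:R < enorm x &
        epi_normal f x a q.1.1 (- q.1.2)],
      exists x a, [/\ (g x <= a%:E)%E, k.+1%:R < enorm x &
        epi_normal g x a q.2.1 (- q.2.2)],
      [/\ enorm q.1.1 <= 1, `|q.1.2| <= 2, enorm q.2.1 <= 1 &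
        `|q.2.2| <= 2 * alpha + 1],
      [/\ enorm (q.1.1 + q.2.1) <= k.+1%:R^-1,
        enorm q.1.1 + q.1.2 - 1 <= k.+1%:R^-1 &
        1 - (enorm q.1.1 + q.1.2) <= k.+1%:R^-1] &
      - q.1.2 <= k.+1%:R^-1 /\ - q.2.2 <= k.+1%:R^-1].
  have e0 : 0 < (k.+1%:R : R)^-1 by rewrite invr_gt0.
  have e1 : (k.+1%:R : R)^-1 <= 1 by rewrite invf_le1 // ler1n.
  have [x [a [u [s [z [c [w [t [[fx xk Nu] [gz zk Nw] s1 uw /andP[t0 t1]]]]]]]]]]
    := H _ e0.
  rewrite invrK in xk zk; move: (k.+1%:R^-1) e0 e1 s1 uw t0 t1.
  move=> e e0 e1 s1 uw t0 t1.
  pose tau := 1 + enorm u; have u0 := enorm_ge0 u.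
  have tau1 : 1 <= tau by rewrite /tau; lra.
  have tau0 : 0 < tau by lra.
  have i0 : 0 < tau^-1 by rewrite invr_gt0.
  have divle (y d : R) : y <= d * tau -> tau^-1 * y <= d.
    by move=> yd; rewrite mulrC ler_pdivrMr.
  have wu : enorm w <= enorm u + e.
    by have := enorm_lerB w (- u); rewrite enormN opprK addrC [w + u]addrC; lra.
  have etau : e <= e * tau by rewrite ler_peMr // ltW.
  have [s1' s2'] : s - 1 < e /\ - (s - 1) < e.
    by move: s1; rewrite ltr_norml => /andP[]; lra.
  exists ((tau^-1 *: u, tau^-1 * s), (tau^-1 *: w, tau^-1 * t)); split=> /=.
  - by exists x, a; split=> //; rewrite -mulrN; exact: epi_normalZ.
  - by exists z, c; split=> //; rewrite -mulrN; exact: epi_normalZ.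
  - rewrite !enormZ !normrM !(gtr0_norm i0); split; apply: divle.
    + by rewrite /tau; lra.
    + by rewrite ler_norml /tau; apply/andP; split; lra.
    + by rewrite /tau; lra.
    + have : alpha * (enorm w + e) <= alpha * (2 * tau).
        by apply: ler_wpM2l (ltW alpha0) _ _ _; rewrite /tau; lra.
      have : 0 <= alpha * tau by rewrite mulr_ge0 ?ltW.
      by rewrite ler_norml => h1 h2; apply/andP; split; lra.
  - rewrite -scalerDr !enormZ (gtr0_norm i0) -mulrDr; split.
    + by apply: divle; lra.
    + rewrite -[1](mulVf (lt0r_neq0 tau0)) -mulrBr; apply: divle.
      by rewrite /tau; rewrite /tau in etau; lra.
    + rewrite -[1](mulVf (lt0r_neq0 tau0)) -mulrBr; apply: divle.
      by rewrite /tau; rewrite /tau in etau; lra.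
  - by rewrite -!mulrN; split; apply: divle; lra.
have [X XP] := choice H'.
pose K : set (('rV[R]_n * R) * ('rV[R]_n * R)) :=
  ([set u | enorm (u - 0) <= 1] `*` `[- 2, 2]%classic) `*`
  ([set u | enorm (u - 0) <= 1] `*` `[- (2 * alpha + 1), 2 * alpha + 1]%classic).
have [||p clp] := compact_seq_cluster K X.
- by do ![apply: compact_setX]; (exact: compact_eball || exact: segment_compact).
- move=> k; have [_ _ [? ? ? ?] _ _] := XP k.
  by split; split; rewrite /= ?subr0 // in_itv /= -ler_norml.
have lim (F : _ -> R) := cluster_le0 X p F clp.
have uw : p.2.1 = - p.1.1.
  have : enorm (p.1.1 + p.2.1) <= 0.
    apply: (lim (fun q => enorm (q.1.1 + q.2.1))); first by continuity.
    by move=> k; have [_ _ _ []] := XP k.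
  rewrite le_eqVlt ltNge enorm_ge0 orbF => /eqP/enorm_eq0/eqP.
  by rewrite addrC addr_eq0 => /eqP.
exists p.1.1, p.1.2, p.2.2; split.
- apply: (cluster_normal_infty f (fun k => (X k).1) p.1 fN) => [k|U N Up].
    by have [] := XP k.
  by apply: (clp [set q | U q.1]); exact: cvg_fst.
- rewrite -uw.
  apply: (cluster_normal_infty g (fun k => (X k).2) p.2 gN) => [k|U N Up].
    by have [] := XP k.
  by apply: (clp [set q | U q.2]); exact: cvg_snd.
- rewrite -oppr_le0; apply: (lim (fun q => - q.1.2)); first by continuity.
  by move=> k; have [_ _ _ _ []] := XP k.
- rewrite -oppr_le0; apply: (lim (fun q => - q.2.2)); first by continuity.
  by move=> k; have [_ _ _ _ []] := XP k.
- have h1 : enorm p.1.1 + p.1.2 - 1 <= 0.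
    apply: (lim (fun q => enorm q.1.1 + q.1.2 - 1)); first by continuity.
    by move=> k; have [_ _ _ [_ ? _] _] := XP k.
  have h2 : 1 - (enorm p.1.1 + p.1.2) <= 0.
    apply: (lim (fun q => 1 - (enorm q.1.1 + q.1.2))); first by continuity.
    by move=> k; have [_ _ _ [_ _ ?] _] := XP k.
  lra.
Qed.

End Limits.

(** * Functions that are Lipschitz at infinity *)

Section LipschitzAtInfinity.
Context {R : realType} {n : nat}.
Implicit Types (g : 'rV[R]_n -> \bar R).
Implicit Types (u v w x y z : 'rV[R]_n) (b c d s t e : R).

(** Moving along [w] at a point of the epigraph raises [g] at rate at most
    [L * |w|], so the normality inequality gives [|w|^2 <= L * |t| * |w|]. *)
Lemma lipschitz_epi_normal g (L r : R) z c w t : 0 < L ->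
  (forall x, r < enorm x -> g x \is a fin_num) ->
  (forall x y, r < enorm x -> r < enorm y ->
     (`|g x - g y| <= (L * enorm (x - y))%:E)%E) ->
  (g z <= c%:E)%E -> r < enorm z -> epi_normal g z c w t ->
  enorm w <= L * `|t|.
Proof.
move=> L0 gfin gL gzc rz N; have [->|w0] := eqVneq w 0.
  by rewrite enorm0 mulr_ge0 // ltW.
have {}w0 := enorm_gt0 _ w0.
apply/ler_addgt0Pr => e e0.
have L1 : 0 < 1 + L by lra.
have [|rho rho0 rN] := N (e / (1 + L)); first by rewrite divr_gt0.
(* A step of length eta stays outside the ball of radius r and moves height
   and base point by less than rho. *)
pose eta := Num.min (rho / (1 + L)) (enorm z - r) / 2.
have eta0 : 0 < eta by rewrite !divr_gt0 // lt_min divr_gt0 // subr_gt0.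
have eta1 : eta * (1 + L) < rho.
  rewrite -ltr_pdivlMr // /eta ltr_pdivrMr //.
  have : 0 < rho / (1 + L) by rewrite divr_gt0.
  have : Num.min (rho / (1 + L)) (enorm z - r) <= rho / (1 + L).
    by rewrite ge_min lexx.
  lra.
have eta2 : eta < enorm z - r.
  rewrite /eta ltr_pdivrMr //.
  have : Num.min (rho / (1 + L)) (enorm z - r) <= enorm z - r.
    by rewrite ge_min lexx orbT.
  lra.
pose a := eta / enorm w; have a0 : 0 < a by rewrite divr_gt0.
have aw : enorm (a *: w) = eta by rewrite enormZ gtr0_norm // divfK // gt_eqF.
pose y := z + a *: w; have yz : y - z = a *: w by rewrite /y addrC addKr.
have ry : r < enorm y.
  by have := enorm_lerB z y; rewrite enormB yz aw; lra.
have [gy gyE] : exists b, g y = b%:E by exists (fine (g y)); rewrite fineK ?gfin.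
have [gz gzE] : exists b, g z = b%:E by exists (fine (g z)); rewrite fineK ?gfin.
have := gL y z ry rz; rewrite yz aw gyE gzE lee_fin => dg.
have := rN y (c + (gy - gz)); rewrite yz aw gyE.
rewrite (_ : c + (gy - gz) - c = gy - gz); last by ring.
have Leta : 0 < L * eta by rewrite mulr_gt0.
have cgz : gz <= c by move: gzc; rewrite gzE lee_fin.
rewrite lee_fin dotvZr -sqr_enorm => h.
have {h} : a * enorm w ^+ 2 + t * (gy - gz) <=
    e / (1 + L) * (eta + `|gy - gz|) by apply: h; lra.
rewrite expr2 mulrA divfK ?gt_eqF // => h.
have h1 : - (t * (gy - gz)) <= `|t| * (L * eta).
  apply: le_trans (_ : `|t| * `|gy - gz| <= _); last by rewrite ler_wpM2l.
  by rewrite -normrM; have := ler_norm (- (t * (gy - gz))); rewrite normrN.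
have h2 : e / (1 + L) * (eta + `|gy - gz|) <= eta * e.
  have h3 : eta + `|gy - gz| <= eta * (1 + L) by lra.
  have eL : 0 <= e / (1 + L) by rewrite divr_ge0 // ltW.
  by apply: le_trans (ler_wpM2l eL h3) _; rewrite mulrCA divfK // gt_eqF.
rewrite -(ler_pM2l eta0); lra.
Qed.

Lemma lipschitz_normal_infty g (L r : R) w t : (forall x, g x != -oo%E) ->
  0 < L -> 0 < r -> (forall x, r < enorm x -> g x \is a fin_num) ->
  (forall x y, r < enorm x -> r < enorm y ->
     (`|g x - g y| <= (L * enorm (x - y))%:E)%E) ->
  normal_infty g (pairv w t) -> enorm w <= L * `|t|.
Proof.
move=> gN L0 r0 gfin gL /(normal_inftyP _ _ _ gN) N.
apply/ler_addgt0Pr => e e0.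
pose d := Num.min r^-1 (e / (1 + L)).
have L1 : 0 < 1 + L by lra.
have d0 : 0 < d by rewrite lt_min invr_gt0 r0 divr_gt0.
have dr : d <= r^-1 by rewrite ge_min lexx.
have de : d * (1 + L) <= e by rewrite -ler_pdivlMr // ge_min lexx orbT.
have [x [a [v [c [gx xd Nx vw ct]]]]] := N d d0.
have rx : r < enorm x.
  by apply: le_lt_trans xd; rewrite -[leLHS]invrK lef_pV2 ?posrE ?invr_gt0.
have := lipschitz_epi_normal _ _ _ _ _ _ _ L0 gfin gL gx rx Nx.
have := enorm_lerB w v; rewrite enormB => h1.
have h2 : `|c| <= `|t| + d.
  by have := ler_normD (c - t) t; rewrite subrK; lra.
have := ler_wpM2l (ltW L0) h2; lra.
Qed.

(** Subgradients exist on a dense subset of the domain: penalising the distance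
    to [x] makes the height function attain a minimum close to [x]. *)
Lemma exists_epi_normal g x b e : lower_semicontinuous g -> g x = b%:E ->
  0 < e -> exists z c w,
    [/\ (g z <= c%:E)%E, enorm (z - x) < e & epi_normal g z c w (- 1)].
Proof.
move=> lsc gx e0.
pose eta := Num.min e (1 / 4).
have eta0 : 0 < eta by rewrite lt_min e0; lra.
have [eta_e eta4] : eta <= e /\ eta <= 1 / 4.
  by split; rewrite ge_min lexx ?orbT.
pose K := [set q : 'rV[R]_n * R |
  [/\ (g q.1 <= q.2%:E)%E, enorm (q.1 - x) <= 1 & `|q.2 - b| <= 1]].
pose phi (q : 'rV[R]_n * R) := q.2.
pose psi (q : 'rV[R]_n * R) := dotv (q.1 - x) (q.1 - x).
pose U := [set q : 'rV[R]_n * R | enorm (q.1 - x) < eta]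
  `&` [set q : 'rV[R]_n * R | `|q.2 - b| < eta].
have [||||||||j j0 [[z c] [[/= gzc _ _] [/= zx cb] cmin]]]
    := @compact_penalty R _ K phi psi (x, b) U.
- exact: compact_epi_box.
- by rewrite /phi; continuity.
- by rewrite /psi; continuity.
- by split; rewrite /= ?subrr ?enorm0 ?normr0 ?gx.
- by move=> q; exact: dotv_ge0.
- by rewrite /psi /= subrr dotv0l.
- move=> [z c] [/= gzc _ _]; rewrite /psi /phi /= => h0 cb.
  have zx : z = x by exact: dotvB_eq0.
  move: gzc; rewrite zx gx lee_fin => bc; congr pair.
  by apply/eqP; rewrite eq_le cb.
- apply: filterI.
    apply: (near_continuous_lt (fun q : 'rV[R]_n * R => enorm (q.1 - x))).
      by continuity.
    by rewrite subrr enorm0.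
  apply: (near_continuous_lt (fun q : 'rV[R]_n * R => `|q.2 - b|)).
    by continuity.
  by rewrite subrr normr0.
exists z, c, (- ((2 * j) *: (z - x))); split=> //; first exact: lt_le_trans eta_e.
apply: (@epi_normal_quadratic _ _ _ _ _ _ _ j (1 / 4)); first lra.
move=> y d gyd yz dc; have := cmin (y, d); rewrite /phi /psi /=.
have yK : K (y, d).
  split=> //=; first by have := enorm_distD y z x; lra.
  by have := ler_distD c d b; lra.
rewrite (dotv_shift x z y) dotvNl dotvZl => /(_ yK).
have := mulr_ge0 (ltW j0) (sqr_ge0 (d - c)); lra.
Qed.

(** Far subgradients exist and have length at most [L], so they accumulate. *)
Lemma lipschitz_subdiff_infty_nonempty g (L r : R) :
  (forall x, g x != -oo%E) -> lower_semicontinuous g ->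
  (forall M, exists x, M < enorm x) ->
  0 < L -> (forall x, r < enorm x -> g x \is a fin_num) ->
  (forall x y, r < enorm x -> r < enorm y ->
     (`|g x - g y| <= (L * enorm (x - y))%:E)%E) ->
  subdiff_infty g !=set0.
Proof.
move=> gN lsc far L0 gfin gL.
have H (k : nat) : exists q : 'rV[R]_n * R, [/\ q.2 = 1, enorm q.1 <= L &
    exists x (a : R), [/\ (g x <= a%:E)%E, k.+1%:R < enorm x &
     epi_normal g x a q.1 (- q.2)]].
  have [x xfar] := far (Num.max (k.+1%:R + 1) (r + 1)).
  move: xfar; rewrite gt_max => /andP[xk xr].
  have gx : g x = (fine (g x))%:E by rewrite fineK // gfin //; lra.
  have [z [c [w [gzc zx Nw]]]] := exists_epi_normal _ _ _ _ lsc gx ltr01.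
  have := enorm_lerB x z; rewrite enormB => xz.
  exists (w, 1); split=> //=; last by exists z, c; split=> //; lra.
  have rz : r < enorm z by lra.
  have := lipschitz_epi_normal _ _ _ _ _ _ _ L0 gfin gL gzc rz Nw.
  by rewrite normrN1 mulr1.
have [X XP] := choice H.
pose K : set ('rV[R]_n * R) := [set u | enorm (u - 0) <= L] `*` [set 1].
have [||p clp] := compact_seq_cluster K X.
- by apply: compact_setX; [exact: compact_eball|exact: compact_set1].
- by move=> k; have [? ? _] := XP k; split=> //=; rewrite subr0.
exists p.1; rewrite /subdiff_infty /=.
have p2 : p.2 = 1.
  have lim (F : _ -> R) := cluster_le0 X p F clp.
  apply/eqP; rewrite eq_le; apply/andP; split; rewrite -subr_le0.
    apply: (lim (fun q => q.2 - 1)); first by continuity.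
    by move=> k; have [-> _ _] := XP k; rewrite subrr.
  apply: (lim (fun q => 1 - q.2)); first by continuity.
  by move=> k; have [-> _ _] := XP k; rewrite subrr.
rewrite -p2; apply: (cluster_normal_infty g X p gN) => // k.
by have [] := XP k.
Qed.

End LipschitzAtInfinity.

(** * The multiplier rule *)

(** The two cases of [circ_subdiff_infty] are the two ways a normal [(w, - t)]
    can be scaled: to last coordinate [-1], or not at all when [t = 0]. *)
Lemma circ_subdiff_infty_normal {R : realType} {n : nat} (g : 'rV[R]_n -> \bar R)
    (w : 'rV[R]_n) (t : R) : (forall x, g x != -oo%E) -> 0 <= t ->
  normal_infty g (pairv w (- t)) -> circ_subdiff_infty t g w.
Proof.
move=> gN t0 N; rewrite /circ_subdiff_infty; case: ifPn => [/eqP t00|tN0].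
  by move: N; rewrite t00 oppr0.
have tpos : 0 < t by rewrite lt_neqAle eq_sym tN0.
exists (t^-1 *: w); last by rewrite scalerA divff // scale1r.
have ti : 0 < t^-1 by rewrite invr_gt0.
have := normal_inftyZ _ _ _ _ gN ti N.
by rewrite mulrN mulVf.
Qed.

Theorem theorem4p2 (R : realType) (n : nat) (f g : 'rV[R]_n -> \bar R)
    (S : set 'rV[R]_n)
    (f_nooo : forall x, f x != -oo%E) (g_nooo : forall x, g x != -oo%E)
    (f_lsc : lower_semicontinuous f) (g_lsc : lower_semicontinuous g)
    (S_def : S = [set x | (g x <= 0)%E]) (S_nonempty : S !=set0)
    (domf_S_unbounded : unbounded (dom f `&` S))
    (f_bounded_below : exists m : R, forall x, S x -> (m%:E <= f x)%E)
    (qualification :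
      opp_set (sing_subdiff_infty f) `&`
        \bigcup_(l in [set l : R | 0 <= l]) circ_subdiff_infty l g = [set 0])
    (f_not_attained : ~ attains_inf f S)
    (S_error_bound : error_bound_infty g S) :
  (exists2 l : R, 0 <= l &
     add_set (subdiff_infty f) (circ_subdiff_infty l g) 0)
  /\
  (lipschitz_infty g ->
   exists2 l : R, 0 <= l &
     add_set (subdiff_infty f) (scale_set l (subdiff_infty g)) 0).
Proof.
have far M : exists2 x, (dom f `&` S) x & M < enorm x.
  apply: contrapT => H; apply: domf_S_unbounded; exists M => x Sx.
  by rewrite leNgt; apply/negP => Mx; apply: H; exists x.
have [x0 Sx0 _] := far 0.
have [alpha [r [alpha0 r0 eb]]] := S_error_bound.
have [u [s [t [Nf Ng s0 t0 us]]]] := normalised_multipliers f g alpha f_nooo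
  g_nooo alpha0 (approximate_multipliers f g S alpha r f_lsc g_lsc S_def
    (ex_intro _ _ Sx0) f_bounded_below f_not_attained alpha0 r0 eb).
(* If s = 0, then u is a unit singular normal of f whose opposite comes from g,
   against the qualification. *)
have spos : 0 < s.
  rewrite lt_neqAle eq_sym s0 andbT; apply/eqP => s00; move: Nf us.
  rewrite s00 oppr0 addr0 => Nf u1.
  have : (opp_set (sing_subdiff_infty f) `&`
      \bigcup_(l in [set l : R | 0 <= l]) circ_subdiff_infty l g) (- u).
    split; first by exists u.
    by exists t => //; exact: circ_subdiff_infty_normal.
  rewrite qualification /= => /eqP; rewrite oppr_eq0 => /eqP u0.
  by move: u1; rewrite u0 enorm0 => /eqP; rewrite eq_sym oner_eq0.
have si : 0 < s^-1 by rewrite invr_gt0.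
have fu : subdiff_infty f (s^-1 *: u).
  have := normal_inftyZ _ _ _ _ f_nooo si Nf.
  by rewrite mulrN mulVf // gt_eqF.
have l0 : 0 <= s^-1 * t by rewrite mulr_ge0 // ltW.
have gu : circ_subdiff_infty (s^-1 * t) g (- (s^-1 *: u)).
  apply: (circ_subdiff_infty_normal _ _ _ g_nooo l0).
  by rewrite -scalerN -mulrN; exact: normal_inftyZ.
split.
  exists (s^-1 * t) => //; exists (s^-1 *: u) => //.
  by exists (- (s^-1 *: u)) => //; rewrite subrr.
move=> [L [r' [L0 r'0 gfin gL]]]; move: gu; rewrite /circ_subdiff_infty.
case: ifPn => [/eqP l00 gu|_ gu]; last first.
  exists (s^-1 * t) => //; exists (s^-1 *: u) => //.
  by exists (- (s^-1 *: u)) => //; rewrite subrr.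
(* The singular subdifferential of g at infinity is trivial, so the multiplier
   is 0 and any subgradient of g at infinity serves as a witness. *)
have u0 : s^-1 *: u = 0.
  have := lipschitz_normal_infty _ _ _ _ _ g_nooo L0 r'0 gfin gL gu.
  rewrite normr0 mulr0 enormN => h; apply: enorm_eq0.
  by apply/eqP; rewrite eq_le h enorm_ge0.
have [v gv] := lipschitz_subdiff_infty_nonempty g L r' g_nooo g_lsc
  (fun M => let: ex_intro2 x _ Mx := far M in ex_intro _ x Mx) L0 gfin gL.
exists 0 => //; exists 0; first by rewrite -u0.
by exists 0; [exists v; rewrite ?scale0r|rewrite addr0].
Qed.
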